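(* Let $\mathcal H$ be a complex Hilbert space, let $(\Sigma,\mathcal M,\mu)$ be a measure space, and let $\pi\in\mathrm{SQ}(\mathbb B(\mathcal H),\mu)$. Then the following assertions hold: (1) If a closed linear subspace $\mathcal H_0\subseteq\mathcal H$ has the property $\pi(\Sigma)\mathcal H_0\subseteq\mathcal H_0$, then either $\mathcal H_0=\{0\}$ or $\mathcal H_0=\mathcal H$. (2) If an operator $T\in\mathbb B(\mathcal H)$ satisfies $T\pi(s)=\pi(s)T$ for almost every $s\in\Sigma$, then $T=z\,1_{\mathcal H}$ for some $z\in\mathbb C$.
   Context: Inner products are linear in the first variable and antilinear in the second. $\mathbb B(\mathcal H)$ denotes the bounded linear operators on $\mathcal H$. For a complex Hilbert space $\mathcal H$ and a measure space $(\Sigma,\mathcal M,\mu)$ ($\mu$ a positive measure), $\mathrm{SQ}(\mathbb B(\mathcal H),\mu)$ denotes the set of all almost everywhere defined, weakly measurable maps $\pi:\Sigma\to\mathbb B(\mathcal H)$ (i.e. $s\mapsto\langle\pi(s)u,v\rangle$ is measurable for all $u,v\in\mathcal H$) such that $$\int_\Sigma\langle\pi(s)u_1,v_1\rangle\langle v_2,\pi(s)u_2\rangle\,d\mu(s)=\langle u_1,u_2\rangle\langle v_2,v_1\rangle\quad\text{for all }u_1,u_2,v_1,v_2\in\mathcal H$$ (equivalently, $\int_\Sigma|\langle\pi(s)u,v\rangle|^2d\mu(s)=\|u\|^2\|v\|^2$ for all $u,v\in\mathcal H$). The condition $\pi(\Sigma)\mathcal H_0\subseteq\mathcal H_0$ means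 $\pi(s)u\in\mathcal H_0$ for all $u\in\mathcal H_0$ and all $s$ at which $\pi$ is defined. *)

(* Defs.v *)
From HB Require Import structures.
From mathcomp Require Import all_boot all_order all_algebra.
From mathcomp Require Import all_classical all_reals all_analysis.
From mathcomp Require Export complex.

Set Implicit Arguments.
Unset Strict Implicit.
Unset Printing Implicit Defensive.

Import Order.TTheory GRing.Theory Num.Theory.
Import numFieldNormedType.Exports.

Local Open Scope classical_set_scope.
Local Open Scope ring_scope.
Local Open Scope complex_scope.

(* A complex Hilbert space is a [completeNormedModType R[i]] whose norm comes
   from an inner product.  [{dot H for Num.conj}] is the type of positive
   definite Hermitian forms, linear in the first variable and antilinear in
   the second. *)
Definition induces_norm (R : realType) (H : normedModType R[i])
    (dot : {dot H for Num.conj}) : Prop :=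
  forall u : H, `|u| ^+ 2 = dot u u.

(* The norm of [H] takes values in [R[i]], hence the cast [M%:C]. *)
Record bounded_operator (R : realType) (H : normedModType R[i]) := BoundedOperator {
  bounded_operator_fun :> {linear H -> H};
  bounded_operatorP : exists M : R, forall u : H,
    `|bounded_operator_fun u| <= M%:C * `|u| }.

Definition closed_subspace (R : realType) (H : normedModType R[i])
    (H0 : set H) : Prop :=
  submod_closed (mem H0) /\ closed H0.

Section complex_integration.
Context d (Sigma : measurableType d) (R : realType).
Variable mu : {measure set Sigma -> \bar R}.
Implicit Types (D : set Sigma) (f : Sigma -> R[i]).

(* The codomain carries the Borel sigma-algebra of [R[i]]; the library puts the
   topology of a concrete numeric field on its regular module [R[i]^o]. *)
Definition complex_measurable_fun D f : Prop :=
  measurable_fun D (f : Sigma -> g_sigma_algebraType (@open R[i]^o)).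

Definition complex_integrable D f : Prop :=
  mu.-integrable D (EFin \o (fun s => complex.Re (f s))) /\
  mu.-integrable D (EFin \o (fun s => complex.Im (f s))).

Definition complex_integral D f : R[i] :=
  (\int[mu]_(s in D) complex.Re (f s)) +i* (\int[mu]_(s in D) complex.Im (f s)).

End complex_integration.

(* An almost everywhere defined map is given by its domain [D] together with a
   total function [pi] whose values outside [D] are never used.  The
   integrability clause says that the integral exists as a Lebesgue integral:
   [complex_integral] alone is total and returns a junk value otherwise. *)
Definition SQ d (Sigma : measurableType d) (R : realType)
    (mu : {measure set Sigma -> \bar R}) (H : normedModType R[i])
    (dot : {dot H for Num.conj})
    (D : set Sigma) (pi : Sigma -> bounded_operator H) : Prop :=
  [/\ measurable D, mu (~` D) = 0%E,
      forall u v : H, complex_measurable_fun D (fun s => dot (pi s u) v) &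
      forall u1 u2 v1 v2 : H,
        let f s := dot (pi s u1) v1 * dot v2 (pi s u2) in
        complex_integrable mu D f /\
        complex_integral mu D f = dot u1 u2 * dot v2 v1 ].

(* Main.v *)
Require Import Defs.
From HB Require Import structures.
From mathcomp Require Import all_boot all_order all_algebra.
From mathcomp Require Import all_classical all_reals all_analysis.
From mathcomp Require Import ring lra.

Import Order.TTheory GRing.Theory Num.Theory.
Import numFieldNormedType.Exports.

Local Open Scope classical_set_scope.
Local Open Scope ring_scope.

(** The defining identity of a square-integrable [pi] says that the matrix
    coefficients [dot (pi s u) v], as functions of [s], determine the numbers
    [dot u x * dot y v]: if the coefficients attached to [(u, v)] and to
    [(u', v')] agree almost everywhere, then
    [dot u x * dot y v = dot u' x * dot y v'] for all [x] and [y]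
    ([SQ_coefficient_ae_eq]).  Both assertions follow from a well-chosen pair
    of equal coefficients.

    - Irreducibility.  If [V] is a proper closed invariant subspace, pick a
      nonzero [v] orthogonal to [V].  For [u] in [V] the coefficient attached to
      [(u, v)] vanishes, as does the one attached to [(0, v)]; hence
      [dot u u * dot v v = 0] and [u = 0].

    - Commutant.  If [T] commutes with almost every [pi s], and [t] is the value
      at [v] of the adjoint of [T], then
      [dot (pi s (T u)) v = dot (T (pi s u)) v = dot (pi s u) t], hence
      [dot (T e) e * dot y v = dot e e * dot y t = dot e e * dot (T y) v].
      With [e] fixed and nonzero, this reads [T y = z *: y] where
      [z = dot (T e) e / dot e e].

    The Hilbert space geometry behind these arguments is the orthogonal
    projection onto a closed subspace ([orthogonal_projection]), where
    completeness enters, and its consequence, the Riesz representation theorem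
    ([Riesz_representation]), which provides [t]. *)

(** * Inner product identities *)

Section InnerProduct.
Context {C : numClosedFieldType} {U : lmodType C} (dot : {dot U for Num.conj}).

Lemma parallelogram (u v : U) :
  dot (u + v) (u + v) + dot (u - v) (u - v) = (dot u u + dot v v) *+ 2.
Proof. by rewrite dnormD dnormB addrACA subrr addr0 mulr2n. Qed.

Lemma dotC (u v : U) : dot u v = (dot v u)^*.
Proof. by rewrite hermC expr0 mul1r. Qed.

(** Pythagoras for the component of [x] orthogonal to [h].  It gives the
    Cauchy-Schwarz inequality, as the left-hand side is nonnegative, and the
    orthogonality of nearest-point residuals, as moving along [h] would
    otherwise shorten [x]. *)
Lemma dot_projection_residual (x h : U) : h != 0 ->
  let y := x - (dot x h / dot h h) *: h in
  dot y y = dot x x - `|dot x h| ^+ 2 / dot h h.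
Proof.
move=> h0 /=; have hh : dot h h != 0 by rewrite dnorm_eq0.
have hhR : (dot h h)^* = dot h h by apply/CrealP/ger0_real/dnorm_ge0.
rewrite dnormB dnormZ linearZr_LR /= rmorphM fmorphV /= hhR.
rewrite normrM normfV (ger0_norm (dnorm_ge0 _ _)).
set a := dot x h; set b := dot h h.
have -> : a^* / b * a = `|a| ^+ 2 / b by rewrite normCK mulrAC [a^* * a]mulrC.
have rE : (`|a| ^+ 2 / b)^* = `|a| ^+ 2 / b.
  by apply/CrealP/ger0_real; rewrite divr_ge0 ?exprn_ge0 ?dnorm_ge0.
rewrite rE exprMn (expr2 b^-1) -!mulrA mulVf// mulr1.
by rewrite opprD addrA addrK.
Qed.

Lemma dot_norm_le (u v : U) : `|dot u v| ^+ 2 <= dot u u * dot v v.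
Proof.
have [->|v0] := eqVneq v 0; first by rewrite linear0r normr0 expr0n mulr_ge0 ?dnorm_ge0.
have := dnorm_ge0 dot (u - (dot u v / dot v v) *: v).
by rewrite dot_projection_residual// subr_ge0 ler_pdivrMr// dnorm_gt0.
Qed.

End InnerProduct.

Lemma ge0_complexE {R : realType} (x : R[i]) : 0 <= x -> x = (complex.Re x)%:C%C.
Proof. by rewrite lecE; case: x => a b /= /andP[/eqP -> _]. Qed.

(** * Projections and functionals in a Hilbert space *)

Section HilbertSpace.
Context {R : realType} {H : completeNormedModType R[i]}.
Context {dot : {dot H for Num.conj}} (dot_norm : induces_norm dot).

(** Norms live in [R[i]], which is only partially ordered; infima and square
    roots of distances are taken in [R]. *)
Definition rnorm (u : H) : R := complex.Re `|u|.

Lemma rnormE (u : H) : `|u| = (rnorm u)%:C%C.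
Proof. exact/ge0_complexE/normr_ge0. Qed.

Lemma rnorm_ge0 (u : H) : 0 <= rnorm u.
Proof. by rewrite -lecR -rnormE normr_ge0. Qed.

Lemma rnorm_triangle (u v w : H) :
  rnorm (u - w) <= rnorm (u - v) + rnorm (v - w).
Proof. by rewrite -lecR rmorphD /= -!rnormE ler_distD. Qed.

Lemma rnorm_dist (u v : H) : rnorm (u - v) = rnorm (v - u).
Proof. by rewrite /rnorm distrC. Qed.

Lemma sqr_rnormE (u : H) : ((rnorm u) ^+ 2)%:C%C = dot u u.
Proof. by rewrite rmorphXn /= -rnormE dot_norm. Qed.

(** The parallelogram identity at [w - x] and [w - y].  When [x] and [y] are
    almost nearest to [w] in a convex set, their midpoint is no nearer than
    the infimum, so the right-hand side is small, and [x] is close to [y]. *)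
Lemma rnorm_midpoint (w x y : H) :
  rnorm (x - y) ^+ 2 = (rnorm (w - x) ^+ 2 + rnorm (w - y) ^+ 2) *+ 2
                       - rnorm (w - 2^-1 *: (x + y)) ^+ 2 *+ 4.
Proof.
apply: (@complexI R); rewrite rmorphB !rmorphMn rmorphD /= !sqr_rnormE.
have := parallelogram dot (w - x) (w - y).
have -> : w - x - (w - y) = y - x.
  by rewrite opprB addrC subrKA.
have -> : w - x + (w - y) = 2 *: (w - 2^-1 *: (x + y)).
  rewrite scalerBr scalerA divff ?pnatr_eq0// scale1r scaler_nat mulr2n.
  by rewrite addrACA opprD.
rewrite dnormZ ger0_norm ?ler0n// -natrX mulr_natl -!sqr_rnormE.
by move=> <-; rewrite addrAC subrr add0r rnorm_dist.
Qed.

(** The points of [V] whose squared distance to [w] is within [e] of the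
    infimum [q] form, as [e] decreases, a filter base; it is Cauchy by
    [rnorm_midpoint], and its limit attains the infimum. *)
Lemma nearest_point_exists (V : set H) (w : H) : closed_subspace V ->
  exists2 p, V p & forall h, V h -> rnorm (w - p) <= rnorm (w - h).
Proof.
move=> [[V0 Vlin] Vcl]; have {}V0 : V 0 by move: V0; rewrite inE.
have Vmid x y : V x -> V y -> V (2^-1 *: (x + y)).
  move=> Vx Vy; have := Vlin 2^-1 x (2^-1 *: y) => /[!inE]; rewrite scalerDr.
  apply=> //; have := Vlin 2^-1 y 0; rewrite !inE addr0; exact.
pose E := [set rnorm (w - h) ^+ 2 | h in V].
pose q := inf E.
have Elb : lbound E 0 by move=> _ [h _ <-]; rewrite sqr_ge0.
have Einf : has_inf E by split; [exists (rnorm (w - 0) ^+ 2), 0|exists 0].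
have qle h : V h -> q <= rnorm (w - h) ^+ 2.
  by move=> Vh; apply: ge_inf; [exists 0|exists h].
have q0 : 0 <= q by apply: lb_le_inf => //; case: Einf.
pose A (e : R) := [set h | V h /\ rnorm (w - h) ^+ 2 < q + e].
pose F := filter_from [set e : R | 0 < e] A.
have FF : ProperFilter F.
  apply: filter_from_proper; last first.
    move=> e /= e0; have [_ [h Vh <-] he] := inf_adherent e0 Einf.
    by exists h.
  apply: filter_from_filter; first by exists 1 => /=.
  move=> a b /= a0 b0; exists (Num.min a b); first by rewrite /= lt_min a0.
  move=> h [Vh hlt]; split; split=> //; apply: (lt_le_trans hlt).
    by rewrite lerD2l ge_min lexx.
  by rewrite lerD2l ge_min lexx orbT.
have Acl e x y : A e x -> A e y -> rnorm (x - y) ^+ 2 < e *+ 4.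
  move=> [Vx hx] [Vy hy]; rewrite (rnorm_midpoint w).
  by have := qle _ (Vmid _ _ Vx Vy); lra.
have FV : F V by exists 1 => //= h [].
have Fc : cauchy F.
  apply: cauchy_exP => eps eps0.
  have epsE := ge0_complexE eps (ltW eps0).
  move: eps0; rewrite epsE ltcR; set r := complex.Re eps => r0.
  have d0 : 0 < r ^+ 2 / 4 by rewrite divr_gt0// exprn_gt0.
  have [_ [x Vx <-] xq] := inf_adherent d0 Einf.
  exists x; exists (r ^+ 2 / 4) => // y Ay.
  rewrite -ball_normE /= rnormE ltcR -(@ltr_pXn2r _ 2) ?nnegrE ?rnorm_ge0 ?ltW//.
  have := @Acl (r ^+ 2 / 4) x y (conj Vx xq) Ay.
  by lra.
have /cvg_ex[/= p Fp] : cvg F by exact: cauchy_cvg.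
exists p; first exact: (@closed_cvg _ _ F _ id _ Vcl FV _ Fp).
(* If some [h] were strictly nearer than [p], the gap between [Num.sqrt q] and
   [rnorm (w - p)] would be positive.  Let [e] be half of it: a point [y] of the
   filter within [Num.sqrt q + e] of [w] and within [e] of [p] contradicts the
   triangle inequality. *)
move=> h Vh; rewrite leNgt; apply/negP => hp.
have qh : Num.sqrt q <= rnorm (w - h).
  by rewrite -(ler_pXn2r (n := 2)) ?nnegrE ?sqrtr_ge0 ?rnorm_ge0// sqr_sqrtr ?qle.
pose e := (rnorm (w - p) - Num.sqrt q) / 2.
have e0 : 0 < e by rewrite divr_gt0// subr_gt0 (le_lt_trans qh).
have FB : F (ball p e%:C%C) by apply: Fp; apply: nbhsx_ballx; rewrite ltcR.
have FA : F (A (e ^+ 2)) by exists (e ^+ 2); rewrite //= exprn_gt0.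
have [y [By [Vy yq]]] := filter_ex (filterI FB FA).
have py : rnorm (y - p) < e.
  by move: By; rewrite -ball_normE /= rnormE ltcR rnorm_dist.
have wy : rnorm (w - y) < Num.sqrt q + e.
  have s0 := sqrtr_ge0 q.
  rewrite -(ltr_pXn2r (n := 2)) ?nnegrE ?rnorm_ge0// ?addr_ge0// ?ltW//.
  apply: (lt_le_trans yq); rewrite sqrrD sqr_sqrtr// lerD2r lerDl.
  by rewrite mulrn_wge0// mulr_ge0// ltW.
have wpE : rnorm (w - p) = Num.sqrt q + e + e by rewrite /e; lra.
by have := rnorm_triangle w y p; rewrite wpE; lra.
Qed.

(** The nearest point [p] works: for [h] in [V], the residual of [w - p] along
    [h] is again of the form [w - h'] with [h'] in [V], so it cannot be shorter
    than [w - p], and [dot_projection_residual] forces [dot (w - p) h = 0]. *)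
Lemma orthogonal_projection (V : set H) (w : H) : closed_subspace V ->
  exists2 p, V p & forall h, V h -> dot h (w - p) = 0.
Proof.
move=> Vcs; have [p Vp pmin] := nearest_point_exists V w Vcs.
exists p => // h Vh; have [->|h0] := eqVneq h 0; first by rewrite linear0l.
set c := dot (w - p) h / dot h h.
have Vpc : V (p + c *: h).
  have [[_ Vlin] _] := Vcs; have := Vlin c h p.
  by rewrite !inE addrC; exact.
have := pmin _ Vpc; rewrite -(ler_pXn2r (n := 2)) ?nnegrE ?rnorm_ge0//.
rewrite -lecR !sqr_rnormE opprD addrA dot_projection_residual// lerBrDr.
rewrite gerDl pmulr_lle0 ?invr_gt0 ?dnorm_gt0// => le0.
have : `|dot (w - p) h| ^+ 2 == 0 by rewrite eq_le le0 exprn_ge0.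
by rewrite expf_eq0 /= normr_eq0 => /eqP wph; rewrite dotC wph conjC0.
Qed.

Lemma dot_bounded (u v : H) : `|dot u v| <= `|u| * `|v|.
Proof.
rewrite -(ler_pXn2r (n := 2)) ?nnegrE ?mulr_ge0//.
by rewrite exprMn !dot_norm dot_norm_le.
Qed.

Lemma bounded_ker_closed (f : {scalar H}) (M : R) :
  (forall u, `|f u| <= M%:C%C * `|u|) -> closed_subspace [set u | f u = 0].
Proof.
move=> fM; split.
  split=> [|a u v]; rewrite !inE /= ?linear0// => fu fv.
  by rewrite linearP fu fv mulr0 addr0.
move=> u clu /=; apply/eqP; rewrite -normr_eq0; apply/eqP/le_anti.
rewrite normr_ge0 andbT.
have fu : `|f u| = (complex.Re `|f u|)%:C%C by exact/ge0_complexE/normr_ge0.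
rewrite fu lecR; apply/ler_addgt0Pr => e e0; rewrite add0r.
have M1 : 0 < `|M| + 1 by rewrite ltr_wpDl.
have [y [/= fy By]] : [set u | f u = 0] `&` ball u (e / (`|M| + 1))%:C%C !=set0.
  by apply: clu; apply: nbhsx_ballx; rewrite ltcR divr_gt0.
rewrite -lecR -fu; have -> : f u = f (u - y) by rewrite linearB fy subr0.
apply: (le_trans (fM _)); move: By; rewrite -ball_normE /= rnormE ltcR => By.
rewrite -rmorphM lecR.
apply: (@le_trans _ _ ((`|M| + 1) * rnorm (u - y))).
  by rewrite ler_wpM2r ?rnorm_ge0// ler_wpDr// ler_norm.
by rewrite mulrC -ler_pdivlMr// ltW.
Qed.

(** A nonzero functional is determined by its kernel and its value at one
    vector [x] orthogonal to that kernel: every [u] differs from a multiple of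
    [x] by an element of the kernel, so [t] is the multiple of [x] fixed by
    [f x = dot x t]. *)
Lemma Riesz_representation (f : {scalar H}) (M : R) :
  (forall u, `|f u| <= M%:C%C * `|u|) -> exists t, forall u, f u = dot u t.
Proof.
move=> fM; have kcs := bounded_ker_closed f M fM.
have [f0|/existsNP[w fw]] := pselect (forall w, f w = 0).
  by exists 0 => u; rewrite linear0r.
have [p fp orth] := orthogonal_projection _ w kcs.
set x := w - p in orth *; have fx : f x != 0.
  by rewrite linearB fp subr0; apply/eqP.
have x0 : x != 0 by apply: contraNneq fx => ->; rewrite linear0.
have xx : dot x x != 0 by rewrite dnorm_eq0.
exists ((f x / dot x x)^* *: x) => u.
have := orth (u - (f u / f x) *: x).
rewrite /= linearB linearZ /= divfK// subrr => /(_ erefl).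
rewrite linearBl linearZl_LR /= => /subr0_eq ux.
rewrite linearZr_LR /= conjCK ux; field.
by rewrite fx xx.
Qed.

(** The vector [t] is the value at [v] of the adjoint of [T]. *)
Lemma adjoint_vector (T : bounded_operator H) (v : H) :
  exists t, forall u, dot (T u) v = dot u t.
Proof.
have lin : scalar (fun u => dot (T u) v).
  by move=> a x y /=; rewrite linearP linearPl.
pose f : {scalar H} := HB.pack (fun u => dot (T u) v)
  (GRing.isLinear.Build _ _ _ _ (fun u => dot (T u) v) lin).
have [M TM] := bounded_operatorP T.
apply: (Riesz_representation f (M * rnorm v)) => u /=.
apply: (le_trans (dot_bounded _ _)).
by rewrite rmorphM /= -rnormE mulrAC ler_wpM2r.
Qed.

End HilbertSpace.

(** * Consequences of square integrability *)

Section SquareIntegrable.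
Context {d : measure_display} {Sigma : measurableType d} {R : realType}.
Context {mu : {measure set Sigma -> \bar R}}.

Lemma complex_integral_ae_eq (D : set Sigma) (f g : Sigma -> R[i]) :
  measurable D -> complex_integrable mu D f -> complex_integrable mu D g ->
  {ae mu, forall s, D s -> f s = g s} ->
  complex_integral mu D f = complex_integral mu D g.
Proof.
move=> mD [fR fI] [gR gI] fg; rewrite /complex_integral /Rintegral.
congr (complex.Complex (fine _) (fine _)).
  apply: ae_eq_integral => //; [exact: measurable_int fR|
                                exact: measurable_int gR|].
  by apply: filterS fg => s /[apply] /= ->.
apply: ae_eq_integral => //; [exact: measurable_int fI|
                              exact: measurable_int gI|].
by apply: filterS fg => s /[apply] /= ->.
Qed.

Context {H : completeNormedModType R[i]} {dot : {dot H for Num.conj}}.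
Context {D : set Sigma} (pi : Sigma -> bounded_operator H).
Hypothesis pi_SQ : SQ mu dot D pi.

(** Both sides are integrals of the products of these coefficients with
    [fun s => dot y (pi s x)]. *)
Lemma SQ_coefficient_ae_eq (u u' v v' : H) :
  {ae mu, forall s, D s -> dot (pi s u) v = dot (pi s u') v'} ->
  forall x y, dot u x * dot y v = dot u' x * dot y v'.
Proof.
move=> uv x y; have [mD _ _ SQint] := pi_SQ.
have [fi <-] := SQint u x v y; have [gi <-] := SQint u' x v' y.
by apply: complex_integral_ae_eq => //; apply: filterS uv => s /[apply] ->.
Qed.

Hypothesis dot_norm : induces_norm dot.

Lemma SQ_irreducible (V : set H) : closed_subspace V ->
  (forall s, D s -> forall u, V u -> V (pi s u)) ->
  V = [set 0] \/ V = [set: H].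
Proof.
move=> Vcs Vpi; have [VT|/existsNP[w Vw]] := pselect (forall w, V w).
  by right; apply/seteqP; split.
left; apply/seteqP; split=> [u Vu /=|_ ->]; last first.
  by have [[+ _] _] := Vcs; rewrite inE.
have [p Vp orth] := orthogonal_projection dot_norm V w Vcs.
have /eqP : dot u u * dot (w - p) (w - p) = dot 0 u * dot (w - p) (w - p).
  apply: SQ_coefficient_ae_eq; apply: aeW => s Ds.
  by rewrite linear0 linear0l orth//; exact: Vpi.
rewrite linear0l mul0r mulf_eq0 !dnorm_eq0 subr_eq0 => /orP[/eqP //|/eqP wp].
by rewrite wp in Vw.
Qed.

Lemma SQ_commutant_scalar (T : bounded_operator H) :
  {ae mu, forall s, D s -> forall u, T (pi s u) = pi s (T u)} ->
  exists z, forall u, T u = z *: u.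
Proof.
move=> Tpi; have [H0|/existsNP[e /eqP e0]] := pselect (forall u : H, u = 0).
  by exists 0 => u; rewrite scale0r.
have ee : dot e e != 0 by rewrite dnorm_eq0.
exists (dot (T e) e / dot e e) => y.
apply/subr0_eq; set z := _ / _; pose v := T y - z *: y.
have [t Tt] := adjoint_vector dot_norm T v.
have key : dot (T e) e * dot y v = dot e e * dot y t.
  apply: SQ_coefficient_ae_eq; apply: filterS Tpi => s /[apply] Tpis.
  by rewrite -Tpis Tt.
have : dot (T y) v = z * dot y v.
  by apply: (mulfI ee); rewrite Tt -key mulrA [dot e e * _]mulrC divfK.
move=> /eqP; rewrite -subr_eq0 -linearZl_LR /= -linearBl dnorm_eq0.
by move/eqP.
Qed.

End SquareIntegrable.

Theorem proposition2p4 (R : realType) (d : measure_display)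
    (Sigma : measurableType d) (mu : {measure set Sigma -> \bar R})
    (H : completeNormedModType R[i]) (dot : {dot H for Num.conj})
    (dot_norm : induces_norm dot)
    (D : set Sigma) (pi : Sigma -> bounded_operator H)
    (pi_SQ : SQ mu dot D pi) :
  (forall H0 : set H, closed_subspace H0 ->
     (forall s : Sigma, D s -> forall u : H, H0 u -> H0 (pi s u)) ->
     H0 = [set 0] \/ H0 = [set: H])
  /\
  (forall T : bounded_operator H,
     {ae mu, forall s : Sigma, D s ->
        forall u : H, T (pi s u) = pi s (T u)} ->
     exists z : R[i], forall u : H, T u = z *: u).
Proof.
split; first exact: (SQ_irreducible pi pi_SQ dot_norm).
exact: (SQ_commutant_scalar pi pi_SQ dot_norm).
Qed.
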